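(* Let $Z = m_1P_1 + \cdots + m_sP_s \subseteq \mathbb{P}^{n_1}\times\cdots\times\mathbb{P}^{n_k}$ be a scheme of fat points, and let $N = n_1+\cdots+n_k$. Then the degree of $Z$ is \[ \deg(Z)=\sum_{i=1}^s \binom{N+m_i-1}{m_i-1}.\]
   Context: Let $\mathbf{k}$ be an algebraically closed field of characteristic zero and let $n_1,\dots,n_k$ be positive integers. The homogeneous coordinate ring of $\mathbb{P}^{n_1}\times\cdots\times\mathbb{P}^{n_k}$ is $R=\mathbf{k}[x_{1,0},\ldots,x_{1,n_1},\ldots,x_{k,0},\ldots,x_{k,n_k}]$, graded by $\mathbb{N}^k$ with $\deg x_{i,j}=e_i$, the $i$th standard basis vector of $\mathbb{Z}^k$ ($\mathbb{N}$ contains $0$). For a point $P$, $I_P\subseteq R$ is its defining prime ideal, which is generated by linear forms $L_{i,1},\dots,L_{i,n_i}$ of degree $e_i$, $i=1,\dots,k$. Given distinct points $P_1,\dots,P_s$ ($s\ge 1$) and positive integers $m_1,\dots,m_s$, the scheme of fat points $Z=m_1P_1+\cdots+m_sP_s$ is the subscheme defined by $I_Z=I_{P_1}^{m_1}\cap\cdots\cap I_{P_s}^{m_s}$. The degree of $Z$ is its length as a $0$-dimensional subscheme of $\mathbb{P}^{n_1}\times\cdots\times\mathbb{P}^{n_k}$. *)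

(* Defs.v *)
From mathcomp Require Import all_boot all_order all_algebra fraction.
From mathcomp Require Import mpoly.

Set Implicit Arguments.
Unset Strict Implicit.
Unset Printing Implicit Defensive.

Import GRing.Theory.
Local Open Scope ring_scope.

Section Ideals.
Context (R : comNzRingType).
Implicit Types (S I : R -> Prop).

Definition ideal_span S (f : R) : Prop :=
  exists (r : nat) (c g : 'I_r -> R),
    (forall j, S (g j)) /\ f = \sum_(j < r) c j * g j.

Definition ideal_exp I (m : nat) : R -> Prop :=
  ideal_span (fun f => exists g : 'I_m -> R,
    (forall j, I (g j)) /\ f = \prod_(j < m) g j).

Definition is_submod (A J : R -> Prop) : Prop :=
  [/\ J 0, forall x y, J x -> J y -> J (x + y)
         & forall a x, A a -> J x -> J (a * x)].

(* By the correspondence of submodules, [J 0], ..., [J l] below induce a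
   strictly increasing chain of [l + 1] submodules of [M / N]. *)
Definition submod_chain (A M N : R -> Prop) (l : nat) (J : nat -> R -> Prop) :
  Prop :=
  [/\ forall t, (t <= l)%N -> is_submod A (J t),
      forall x, N x -> J 0%N x,
      forall x, J l x -> M x
    & forall t, (t < l)%N ->
        (forall x, J t x -> J t.+1 x) /\ exists x, J t.+1 x /\ ~ J t x].

(* The [A]-module [M / N] has finite length [l]; [A] is a subring of [R] and
   [N], [M] are [A]-submodules of [R] with [N] contained in [M]. *)
Definition is_length (A M N : R -> Prop) (l : nat) : Prop :=
  (exists J, submod_chain A M N l J) /\
  (forall l' J, submod_chain A M N l' J -> (l' <= l)%N).

Lemma is_length_uniq A M N l l' :
  is_length A M N l -> is_length A M N l' -> l = l'.
Proof.
move=> [[J cJ] maxl] [[J' cJ'] maxl'].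
by apply/eqP; rewrite eqn_leq (maxl' _ _ cJ) (maxl _ _ cJ').
Qed.

End Ideals.

Section MultiprojectiveSpace.
Context (K : fieldType) (k : nat) (n : 'I_k -> nat).

(* A point of the projective space of dimension [d] is a line through the
   origin of the space of row vectors of size [d + 1]. *)
Definition proj_space (d : nat) := {L : {vspace 'rV[K]_d.+1} | \dim L == 1%N}.

Definition mpoint := {dffun forall i : 'I_k, proj_space (n i)}.

(* The variable [x_{i,j}] is ['X_v] for the [v] such that [tagnat.sig1 v = i]
   and [tagnat.sig2 v = j]. *)
Definition mring := {mpoly K[\sum_(i < k) (n i).+1]}.

Implicit Types (P : mpoint) (f g : mring) (I : mring -> Prop).

Definition is_coords P (x : forall i : 'I_k, 'rV[K]_(n i).+1) : Prop :=
  forall i, (<[x i]> = val (P i))%VS.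

Definition meval_coords (x : forall i : 'I_k, 'rV[K]_(n i).+1) f : K :=
  f.@[fun v => x (tagnat.sig1 v) 0 (tagnat.sig2 v)].

Definition vanishes_at P f : Prop :=
  forall x, is_coords P x -> meval_coords x f = 0.

(* As usual, 0 is homogeneous of every multidegree. *)
Definition is_mhomog (d : 'I_k -> nat) f : Prop :=
  forall mon, mon \in msupp f ->
    forall i, (\sum_(v | tagnat.sig1 v == i) mon v)%N = d i.

Definition point_ideal P : mring -> Prop :=
  ideal_span (fun f => (exists d, is_mhomog d f) /\ vanishes_at P f).

Definition fat_points_ideal (s : nat) (P : 'I_s -> mpoint) (m : 'I_s -> nat) :
  mring -> Prop :=
  fun f => forall i, ideal_exp (point_ideal (P i)) (m i) f.

(* The stalk at [P] of the ideal sheaf associated with [I], as a subset of the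
   fraction field of the coordinate ring: the part of multidegree 0 of the
   localization of [I] at the multihomogeneous elements outside of
   [point_ideal P]. *)
Definition stalk I P : {fraction mring} -> Prop :=
  fun q => exists (d : 'I_k -> nat) f g,
    [/\ is_mhomog d f, is_mhomog d g, I f, ~ point_ideal P g
      & q = tofrac f / tofrac g].

Definition local_ring P : {fraction mring} -> Prop := stalk (fun=> True) P.

(* The local ring at [P] of the subscheme defined by [I] is
   [local_ring P / stalk I P]; it has length [l]. *)
Definition local_length I P (l : nat) : Prop :=
  is_length (local_ring P) (local_ring P) (stalk I P) l.

(* The subscheme defined by [I] is supported at finitely many closed points,
   and the sum over all closed points of the lengths of its local rings is
   [d]. *)
Definition is_degree I (d : nat) : Prop :=
  exists l : mpoint -> nat, (forall P, local_length I P (l P)) /\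
    exists ps : seq mpoint,
      [/\ uniq ps, forall P, l P != 0%N -> P \in ps
        & d = (\sum_(P <- ps) l P)%N].

Lemma is_degree_uniq I d d' : is_degree I d -> is_degree I d' -> d = d'.
Proof.
move=> [l [lP [ps [ups sps ->]]]] [l' [lP' [ps' [ups' sps' ->]]]].
have El P : l' P = l P by exact: is_length_uniq (lP' P) (lP P).
rewrite [in RHS](eq_bigr l) => [|P _]; last by rewrite El.
have supp r : (\sum_(P <- r) l P = \sum_(P <- [seq P <- r | l P != 0]) l P)%N.
  by rewrite big_filter [RHS]big_mkcond; apply: eq_bigr => P _; case: eqP.
rewrite supp [RHS]supp; apply/perm_big/uniq_perm; rewrite ?filter_uniq // => P.
rewrite !mem_filter; case: (boolP (l P == 0%N)) => //= lP0.
by rewrite sps // sps' // El.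
Qed.

End MultiprojectiveSpace.

(* Main.v *)
From HB Require Import structures.
Require Import Defs.
From mathcomp Require Import all_boot all_order all_algebra fraction.
From mathcomp Require Import mpoly.

Set Implicit Arguments.
Unset Strict Implicit.
Unset Printing Implicit Defensive.

Import GRing.Theory.
Local Open Scope ring_scope.

(** The scheme is supported at the points P_i, and its local ring at a point of
    multiplicity m has the length of K[y_1..y_N] / (y_1..y_N)^m, that is, the
    number of monomials of degree less than m in N variables.

    The local study at a point P happens in one affine chart. Choose coordinates
    x of P having in every factor an entry 1, the pivot. Setting the pivot
    variables to 1 and moving P to the origin is a ring morphism [chart] from
    the coordinate ring to K[y_1..y_N], with [f(x)] as the constant term of
    [chart f]. So a degree 0 fraction f / g with g(x) nonzero has an expansion
    at P, and whether the coefficients of [chart f] vanish on a set of monomials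
    closed under divisors depends on the fraction only: the denominator expands
    to a unit of the power series ring ([vanish_on_cancel],
    [germ_vanish_numerator]).

    The stalk at P of the ideal of the scheme is the set of the germs whose
    numerator expands to order at least m ([stalk_fat_points]). Generators of
    the m-th power of the ideal of P do expand to order m. Conversely a
    multihomogeneous f is recovered from [chart f] by homogenizing
    ([rehom_chart]), which turns each y_w into a linear form through P divided
    by a pivot variable. So f lies in the m-th power of the ideal of P once the
    pivots are cleared ([mhomog_ideal_exp]), and a form that does not vanish at
    P brings it into the ideals of the other points ([separating_form_exp]).
    Both multipliers are invertible at P.

    For the length, list the D monomials of degree less than m by increasing
    degree. Germs that vanish on the initial segments of this list form a chain
    of D + 1 submodules ([exists_submod_chain]). No chain is longer: germs
    chosen from the successive steps of a chain would have linearly dependent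
    expansions modulo order m, although each lies outside of the submodule that
    contains its predecessors ([submod_chain_leq]). Finally D is a binomial
    coefficient ([card_bmultinom]). *)

(** * Monomials of bounded degree *)

(** A monomial of degree at most [b] is a sequence of [n] exponents with sum at
    most [b]. *)
Lemma card_bmultinom n b : #|{: 'X_{1..n < b.+1}}| = 'C(n + b, b).
Proof.
rewrite -bin_sub ?leq_addl // addnK -card_partial_ord_partitions.
pose f (a : 'X_{1..n < b.+1}) : n.-tuple 'I_b.+1 := [tuple inord (a i) | i < n].
have lt_a (a : 'X_{1..n < b.+1}) i : (a i < b.+1)%N.
  by apply: leq_ltn_trans (bmdeg a); rewrite mdegE (bigD1 i) //= leq_addr.
have f_inj : injective f.
  move=> a a' /(congr1 (fun t => tnth t)) eq_f; apply/val_inj/mnmP => i.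
  have /(congr1 val) := congr1 (fun t => t i) eq_f.
  by rewrite !tnth_mktuple /= !inordK.
rewrite -cardsT -(card_imset _ f_inj); apply: eq_card => t; rewrite inE.
apply/imsetP/idP => [[a _ ->]|le_t].
  rewrite big_tuple -ltnS; apply: leq_ltn_trans (bmdeg a).
  by rewrite mdegE leq_sum // => i _; rewrite tnth_mktuple inordK.
pose a : 'X_{1..n} := [multinom (tnth t i : nat) | i < n].
have lt_ab : (mdeg a < b.+1)%N.
  rewrite ltnS mdegE; move: le_t; rewrite big_tuple.
  by under [X in _ -> (X <= _)%N]eq_bigr do rewrite mnmE.
exists (BMultinom lt_ab) => //; apply: eq_from_tnth => i.
by apply: val_inj; rewrite tnth_mktuple /= mnmE inordK.
Qed.

(** * Spans, powers of ideals and chains of submodules *)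

Section Ideals.
Context (R : comNzRingType).
Implicit Types (S I J : R -> Prop).

Lemma ideal_span_gen S f : S f -> ideal_span S f.
Proof.
by move=> Sf; exists 1%N, (fun=> 1), (fun=> f); rewrite big_ord1 mul1r.
Qed.

Lemma ideal_span_min S J :
    J 0 -> (forall f g, J f -> J g -> J (f + g)) ->
    (forall c f, S f -> J (c * f)) ->
  forall f, ideal_span S f -> J f.
Proof.
move=> J0 JD JM f [r [c [g [Sg ->]]]]; elim/big_rec: _ => // j h _.
by apply: JD; apply: JM.
Qed.

Lemma ideal_span0 S : ideal_span S 0.
Proof.
by exists 0%N, (fun=> 0), (fun=> 0); rewrite big_ord0; split=> // -[].
Qed.

Lemma ideal_spanD S f g :
  ideal_span S f -> ideal_span S g -> ideal_span S (f + g).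
Proof.
move=> [r [c [u [Su ->]]]] [r' [c' [u' [Su' ->]]]].
pose glue T (a : 'I_r -> T) (a' : 'I_r' -> T) j :=
  match split j with inl i => a i | inr i => a' i end.
exists (r + r')%N, (glue _ c c'), (glue _ u u'); split.
  by move=> j; rewrite /glue; case: split.
rewrite big_split_ord; congr (_ + _); apply: eq_bigr => j _; rewrite /glue.
  by case: split_ordP => i /eqP; rewrite (eq_lshift, eq_lrshift) // => /eqP ->.
by case: split_ordP => i /eqP; rewrite (eq_rshift, eq_rlshift) // => /eqP ->.
Qed.

Lemma ideal_spanM S a f : ideal_span S f -> ideal_span S (a * f).
Proof.
move=> [r [c [u [Su ->]]]]; exists r, (fun j => a * c j), u; split=> //.
by rewrite mulr_sumr; apply: eq_bigr => j _; rewrite mulrA.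
Qed.

Lemma ideal_exp0 I f : ideal_exp I 0 f.
Proof.
rewrite -[f]mulr1; apply/ideal_spanM/ideal_span_gen.
by exists (fun=> 0); rewrite big_ord0; split=> // -[].
Qed.

Lemma ideal_exp1 I f : I f -> ideal_exp I 1 f.
Proof.
by move=> If; apply: ideal_span_gen; exists (fun=> f); rewrite big_ord1.
Qed.

Lemma ideal_expM I a b f g :
  ideal_exp I a f -> ideal_exp I b g -> ideal_exp I (a + b) (f * g).
Proof.
move=> If Ig; move: f If; apply: ideal_span_min => [|f f' If If'|c f If].
- by rewrite mul0r; apply: ideal_span0.
- by rewrite mulrDl; apply: ideal_spanD.
move: g Ig; apply: ideal_span_min => [|g g' Ig Ig'|d g Ig].
- by rewrite mulr0; apply: ideal_span0.
- by rewrite mulrDr; apply: ideal_spanD.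
rewrite mulrACA; apply/ideal_spanM/ideal_span_gen.
case: If Ig => [u [Iu ->]] [v [Iv ->]].
exists (fun j => match split j with inl i => u i | inr i => v i end); split.
  by move=> j; case: split.
rewrite big_split_ord; congr (_ * _); apply: eq_bigr => j _.
  by case: split_ordP => i /eqP; rewrite (eq_lshift, eq_lrshift) // => /eqP ->.
by case: split_ordP => i /eqP; rewrite (eq_rshift, eq_rlshift) // => /eqP ->.
Qed.

Lemma ideal_expX I m f : I f -> ideal_exp I m (f ^+ m).
Proof.
move=> If; elim: m => [|m IHm]; first exact: ideal_exp0.
by rewrite exprS -add1n; apply: ideal_expM IHm; apply: ideal_exp1.
Qed.

Lemma ideal_exp_leq I a b f : (a <= b)%N -> ideal_exp I b f -> ideal_exp I a f.
Proof.
move=> le_ab; apply: ideal_span_min => [||c _ [u [Iu ->]]].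
- exact: ideal_span0.
- exact: ideal_spanD.
rewrite -(subnKC le_ab) in u Iu *.
rewrite big_split_ord mulrCA mulrC; apply/ideal_spanM/ideal_span_gen.
by exists (fun j => u (lshift _ j)).
Qed.

Lemma submod_chain_mono (A M N : R -> Prop) l (J : nat -> R -> Prop) s t :
    submod_chain A M N l J ->
  (s <= t <= l)%N -> forall q, J s q -> J t q.
Proof.
case=> _ _ _ inc /andP[le_st le_tl] q Jsq; elim: t le_st le_tl => [|t IHt].
  by rewrite leqn0 => /eqP <-.
rewrite leq_eqVlt => /orP[/eqP<- //|lt_st] lt_tl.
by have [sub _] := inc t lt_tl; apply/sub/IHt => //; apply: ltnW.
Qed.

Lemma is_submod_sum (A J : R -> Prop) T (r : seq T) (D : pred T) (f : T -> R) :
  is_submod A J -> (forall i, D i -> J (f i)) -> J (\sum_(i <- r | D i) f i).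
Proof. by move=> [J0 JD _] Jf; elim/big_rec: _ => // i q /Jf; apply: JD. Qed.

End Ideals.

(** * Polynomials with prescribed vanishing coefficients *)

Section VanishOn.
Context (R : idomainType) (n : nat).
Implicit Types (L : {pred 'X_{1..n}}) (f g : {mpoly R[n]}).

Definition vanish_on L f := {in L, forall a, f@_a = 0}.

Definition lower_set L :=
  forall a b : 'X_{1..n}, (a <= b)%MM -> b \in L -> a \in L.

Lemma vanish_onD L f g : vanish_on L f -> vanish_on L g -> vanish_on L (f + g).
Proof. by move=> Lf Lg a La; rewrite mcoeffD Lf ?Lg ?addr0. Qed.

(** Every coefficient of [g * f] at a monomial [a] is a combination of
    coefficients of [f] at divisors of [a]: the polynomials that vanish on a
    set closed under divisors form an ideal. *)
Lemma vanish_onM L f g : lower_set L -> vanish_on L f -> vanish_on L (g * f).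
Proof.
move=> lowL Lf a La; rewrite mcoeffM big1 // => -[[b ?] [c ?]] /= /eqP eq_a.
by rewrite Lf ?mulr0 //; apply: lowL La; rewrite eq_a lem_addl.
Qed.

(** Over the fraction field of [R], [g] is a unit of the power series ring.
    Without inverting it, induct on the degree of the monomial: the coefficient
    of [g * f] at [a] is [g@_0 * f@_a] plus terms with coefficients of [f] at
    proper divisors of [a]. *)
Lemma vanish_on_cancel L f g : lower_set L -> g@_0 != 0 ->
  vanish_on L (g * f) -> vanish_on L f.
Proof.
move=> lowL g0 Lgf a; move: {2}(mdeg a).+1 (ltnSn (mdeg a)) => d.
elim: d a => // d IHd a lt_ad La; apply: (mulfI g0); rewrite mulr0 -(Lgf a La).
rewrite mcoeffM (bigD1 (bm0, BMultinom (ltnSn (mdeg a)))) /=; last first.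
  by rewrite add0m.
rewrite [X in _ = _ + X]big1 ?addr0 // => -[[b ?] [c ?]] /=.
case/andP=> /eqP eq_a neq_bc.
rewrite (IHd c) ?mulr0 //; last by apply: lowL La; rewrite eq_a lem_addl.
apply: leq_trans (lt_ad : (mdeg a <= d)%N).
rewrite eq_a mdegD -[X in (X < _)%N]add0n ltn_add2r.
rewrite lt0n mdeg_eq0; apply: contraNneq neq_bc => b0.
rewrite xpair_eqE !bmeqP /= b0 eqxx; apply/eqP.
by rewrite eq_a b0 add0m.
Qed.

Definition deg_lt m : {pred 'X_{1..n}} := [pred a : 'X_{1..n} | (mdeg a < m)%N].

Lemma lower_deg_lt m : lower_set (deg_lt m).
Proof.
move=> a b le_ab; rewrite !inE; apply: leq_ltn_trans.
by rewrite -(submK le_ab) mdegD leq_addl.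
Qed.

Lemma vanish_deg_ltM l m f g :
    vanish_on (deg_lt l) f -> vanish_on (deg_lt m) g ->
  vanish_on (deg_lt (l + m)) (f * g).
Proof.
move=> Lf Lg a; rewrite inE => lt_a.
rewrite mcoeffM big1 // => -[[b ?] [c ?]] /= /eqP eq_a.
have [lt_b|le_b] := ltnP (mdeg b) l; first by rewrite Lf ?mul0r.
rewrite Lg ?mulr0 // inE -(ltn_add2l l); apply: leq_ltn_trans lt_a.
by rewrite eq_a mdegD leq_add2r.
Qed.

(** The order on monomials compares degrees first and extends divisibility, so
    each initial segment of this list is closed under divisors. *)
Definition low_monomials m : seq 'X_{1..n} :=
  sort <=%O [seq val a | a <- enum {: 'X_{1..n < m}}].

Lemma mem_low_monomials m : low_monomials m =i deg_lt m.
Proof.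
move=> a; rewrite mem_sort; apply/mapP/idP => [[b _ ->]|lt_a].
  by rewrite inE bmdeg.
by exists (BMultinom lt_a); rewrite ?mem_enum.
Qed.

Lemma size_low_monomials m : size (low_monomials m) = #|{: 'X_{1..n < m}}|.
Proof. by rewrite size_sort size_map -cardE. Qed.

Lemma uniq_low_monomials m : uniq (low_monomials m).
Proof. by rewrite sort_uniq map_inj_uniq ?enum_uniq //; apply: val_inj. Qed.

Lemma lower_take_low_monomials m r :
  lower_set [pred a in take r (low_monomials m)].
Proof.
move=> a b le_ab; rewrite !inE => b_r.
have b_m := mem_take b_r; have a_m : a \in low_monomials m.
  by move: b_m; rewrite !mem_low_monomials; apply: lower_deg_lt.
move: b_r; rewrite !in_take //; apply: leq_ltn_trans.
rewrite leqNgt; apply/negP => lt_ba.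
have := sorted_ltn_index Order.POrderTheory.le_trans
  (Order.TotalTheory.sort_le_sorted _) _ _ b_m a_m lt_ba.
move=> le_ba; move: lt_ba; suff -> : a = b by rewrite ltnn.
by apply: Order.POrderTheory.le_anti; rewrite (lem_leo le_ab).
Qed.

End VanishOn.

(** * Multihomogeneous polynomials *)

Section Multidegree.
Context (K : fieldType) (k : nat) (n : 'I_k -> nat).
Local Notation S := (mring K n).
Implicit Types (f g : S) (d : 'I_k -> nat).

Lemma mhomog0 d : is_mhomog d (0 : S).
Proof. by move=> a; rewrite mcoeff_msupp mcoeff0 eqxx. Qed.

Lemma mhomogD d f g : is_mhomog d f -> is_mhomog d g -> is_mhomog d (f + g).
Proof.
by move=> df dg a /msuppD_le; rewrite mem_cat => /orP[/df|/dg].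
Qed.

Lemma mhomogM d d' f g :
  is_mhomog d f -> is_mhomog d' g -> is_mhomog (fun i => d i + d' i)%N (f * g).
Proof.
move=> df dg a /msuppM_le/allpairsP[[b c] /= [/df db /dg dc ->]] i.
by rewrite -db -dc -big_split; apply: eq_bigr => v _; rewrite mnmDE.
Qed.

Lemma mhomogZ d c f : is_mhomog d f -> is_mhomog d (c *: f).
Proof. by move=> df a /msuppZ_le/df. Qed.

Lemma mhomogC c : is_mhomog (fun=> 0%N) (c%:MP : S).
Proof.
move=> a; rewrite msuppC; case: eqP => // _; rewrite inE => /eqP-> i.
by rewrite big1 // => v _; rewrite mnm0E.
Qed.

Lemma mhomogX v : is_mhomog (fun i => tagnat.sig1 v == i : nat) ('X_v : S).
Proof.
move=> a; rewrite msuppX inE => /eqP-> i.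
rewrite (bigID (pred1 v)) /= [X in (_ + X)%N]big1 ?addn0; last first.
  by move=> w /andP[_ /negPf neq_w]; rewrite mnm1E eq_sym neq_w.
case: eqVneq => vi.
  rewrite (big_pred1 v) ?mnm1E ?eqxx // => w /=.
  by case: (eqVneq w v) => [->|]; rewrite ?vi ?eqxx ?andbF.
by rewrite big1 // => w /andP[/eqP wi /eqP wv]; rewrite -wi wv eqxx in vi.
Qed.

Lemma mhomog_sum d (I : Type) (r : seq I) (F : I -> S) :
  (forall j, is_mhomog d (F j)) -> is_mhomog d (\sum_(j <- r) F j).
Proof.
by move=> dF; elim/big_rec: _ => [|j f _]; [apply: mhomog0 | apply: mhomogD].
Qed.

Lemma mhomog_prod (I : Type) (r : seq I) (B : pred I)
    (d : I -> 'I_k -> nat) (F : I -> S) :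
    (forall j, is_mhomog (d j) (F j)) ->
  is_mhomog (fun i => \sum_(j <- r | B j) d j i)%N (\prod_(j <- r | B j) F j).
Proof.
move=> dF; elim: r => [|j r IHr].
  by rewrite big_nil => a /(@mhomogC 1) da i; rewrite big_nil da.
rewrite big_cons => a; case: ifP => Bj da i; rewrite big_cons Bj.
  exact: mhomogM (dF j) IHr _ da i.
exact: IHr.
Qed.

Lemma mhomogXn d f m : is_mhomog d f -> is_mhomog (fun i => d i * m)%N (f ^+ m).
Proof.
move=> df; elim: m => [|m IHm] a.
  by move=> /(@mhomogC 1) da i; rewrite muln0 da.
by rewrite exprS => /(mhomogM df IHm) da i; rewrite mulnS da.
Qed.

(** Multihomogeneity makes the vanishing of [f] at a point independent of the
    choice of coordinates in each factor. *)
Lemma meval_mhomog_scale d f x y (c : 'I_k -> K) : is_mhomog d f ->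
    (forall i, y i = c i *: x i) ->
  meval_coords y f = (\prod_i c i ^+ d i) * meval_coords x f.
Proof.
move=> df y_cx; rewrite /meval_coords !mevalE mulr_sumr.
apply: eq_big_seq => a a_f; rewrite mulrCA; congr (_ * _).
under eq_bigr do rewrite y_cx mxE exprMn.
rewrite big_split /=; congr (_ * _).
rewrite (partition_big (@tagnat.sig1 _ _) predT) //=; apply: eq_bigr => i _.
rewrite -(df a a_f i) -prodrXr; apply: eq_bigr => v /eqP <-.
by [].
Qed.

End Multidegree.

(** * Coordinates and the ideal of a point *)

Section Points.
Context (K : fieldType) (k : nat) (n : 'I_k -> nat).
Implicit Types (P Q : mpoint K n) (f g : mring K n).

Lemma proj_space_coords d (L : proj_space K d) :
  exists u : 'rV[K]_d.+1 * 'I_d.+1, (<[u.1]> = val L)%VS /\ u.1 0 u.2 = 1.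
Proof.
case: L => /= L dimL; pose v := vpick L.
have v0 : v != 0 by rewrite vpick0 -dimv_eq0 (eqP dimL).
have [j vj|v_0] := pickP (fun j => v 0 j != 0); last first.
  by case/eqP: v0; apply/rowP => j; rewrite mxE; apply/eqP/negbFE/v_0.
exists ((v 0 j)^-1 *: v, j); rewrite mxE mulVf //; split=> //.
apply/eqP; rewrite eqEdim -memvE memvZ ?memv_pick //= (eqP dimL).
by rewrite dim_vline scaler_eq0 invr_eq0 (negPf vj) (negPf v0).
Qed.

(** The entry [p i], equal to 1, is the pivot of the [i]-th factor: the point
    lies in the affine chart where the pivot variables do not vanish. *)
Lemma normalized_coords P :
  exists (x : forall i, 'rV[K]_(n i).+1) (p : forall i, 'I_(n i).+1),
    is_coords P x /\ forall i, x i 0 (p i) = 1.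
Proof.
have [u uP] := fin_all_exists (fun i => proj_space_coords (P i)).
by exists (fun i => (u i).1), (fun i => (u i).2); split=> i; case: (uP i).
Qed.

Lemma coords_scale P x y : is_coords P x -> is_coords P y ->
  exists c : 'I_k -> K, forall i, y i = c i *: x i.
Proof.
move=> xP yP; apply: (@fin_all_exists _ _ (fun i c => y i = c *: x i)) => i.
apply/vlineP.
by rewrite xP -yP memv_line.
Qed.

Lemma mhomog_vanishes_at P x d f : is_coords P x -> is_mhomog d f ->
  meval_coords x f = 0 -> vanishes_at P f.
Proof.
move=> xP df fx0 y yP; have [c y_cx] := coords_scale xP yP.
by rewrite (meval_mhomog_scale df y_cx) fx0 mulr0.
Qed.

Lemma point_ideal_meval P x f :
  is_coords P x -> point_ideal P f -> meval_coords x f = 0.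
Proof.
move=> xP; move: f; apply: ideal_span_min => [|g h g0 h0|c g [_ gP]].
- exact: meval0.
- by rewrite /meval_coords mevalD [X in X + _]g0 [X in _ + X]h0 addr0.
- by rewrite /meval_coords mevalM [X in _ * X](gP x xP) mulr0.
Qed.

Lemma mhomog_point_ideal P x d f : is_coords P x -> is_mhomog d f ->
  point_ideal P f <-> meval_coords x f = 0.
Proof.
move=> xP df; split; first exact: point_ideal_meval.
move=> fx0; apply: ideal_span_gen; split; first by exists d.
exact: mhomog_vanishes_at xP df fx0.
Qed.

End Points.

(** * The affine chart at a point *)

Section AffineChart.
Context (K : fieldType) (k : nat) (n : 'I_k -> nat).
Context (x : forall i, 'rV[K]_(n i).+1) (p : forall i, 'I_(n i).+1).
Context (xp : forall i, x i 0 (p i) = 1).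
Local Notation S := (mring K n).
Local Notation N := (\sum_(i < k) n i)%N.
Local Notation A := {mpoly K[N]}.
Local Notation F := {fraction S}.
Implicit Types (f g : S) (w : 'I_N).

(** The image of the variable of index [u] in the coordinates [y] of the chart
    centered at the point: the pivot becomes its value, namely 1, and another
    variable its value at the point plus its own [y]. *)
Definition chart_var (u : {i & 'I_(n i).+1}) : A :=
  (x (tag u) 0 (tagged u))%:MP +
  if unlift (p (tag u)) (tagged u) is Some j then 'X_(tagnat.Rank _ j) else 0.

Definition chart : S -> A := mmap (@mpolyC N K) (chart_var \o tagnat.sig).
HB.instance Definition _ := GRing.RMorphism.on chart.

Definition pivot i : S := 'X_(tagnat.Rank _ (p i)).

Definition pivot_pow (d : 'I_k -> nat) : S := \prod_i pivot i ^+ d i.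

(** The linear forms of one factor that vanish at the point; they generate its
    ideal, and they are the forms that separate it from other points. *)
Definition centered_form (i : 'I_k) (j : 'I_(n i).+1) : S :=
  'X_(tagnat.Rank _ j) - x i 0 j *: pivot i.

Definition local_param w : S :=
  centered_form (lift (p (tagnat.sig1 w)) (tagnat.sig2 w)).

Lemma local_param_Rank i (j : 'I_(n i)) :
  local_param (tagnat.Rank i j) = centered_form (lift (p i) j).
Proof.
rewrite /local_param /tagnat.sig2 /tagnat.sig1 /tagnat.Rank.
by rewrite tagnat.rankK.
Qed.

Lemma chartZ c f : chart (c *: f) = c *: chart f.
Proof. by rewrite /chart mmapZ mul_mpolyC. Qed.

Lemma chartX v : chart 'X_v = chart_var (tagnat.sig v).
Proof. by rewrite /chart mmapX mmap1U. Qed.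

Lemma chartX_Rank i (j : 'I_(n i).+1) :
  chart 'X_(tagnat.Rank _ j) = chart_var (Tagged _ j).
Proof. by rewrite chartX tagnat.rankK. Qed.

Lemma chart_pivot i : chart (pivot i) = 1.
Proof. by rewrite chartX_Rank /chart_var /= unlift_none xp addr0. Qed.

(** Hence every monomial in [y] is the expansion of a multihomogeneous
    polynomial, which makes the inclusions in [exists_submod_chain] strict. *)
Lemma chart_local_param w : chart (local_param w) = 'X_w.
Proof.
rewrite /local_param /centered_form rmorphB /= chartX_Rank chartZ chart_pivot.
rewrite /chart_var /= liftK tagnat.sig2K -mul_mpolyC mulr1.
by rewrite addrAC subrr add0r.
Qed.

Lemma chart_const f : (chart f)@_0 = meval_coords x f.
Proof.
rewrite /chart /mmap /meval_coords mevalE (rmorph_sum (mcoeff 0%MM)).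
apply: eq_bigr => a _; rewrite rmorphM /= mpolyCK rmorph_prod.
congr (_ * _); apply: eq_bigr => v _; rewrite rmorphXn /=.
rewrite /chart_var raddfD /= mpolyCK; case: unlift => [j|].
  by rewrite mcoeffX mnm1_eq0 addr0.
by rewrite mcoeff0 addr0.
Qed.

Lemma meval_var (i : 'I_k) (j : 'I_(n i).+1) :
  meval_coords x ('X_(tagnat.Rank _ j) : S) = x i 0 j.
Proof.
rewrite /meval_coords mevalXU /tagnat.sig2 /tagnat.sig1 /tagnat.Rank.
by rewrite tagnat.rankK.
Qed.

Lemma mhomog_pivot i : is_mhomog (fun l => i == l : nat) (pivot i).
Proof. by move=> a /mhomogX ha l; rewrite ha tagnat.Rank1K. Qed.

Lemma mhomog_centered_form i j :
  is_mhomog (fun l => i == l : nat) (@centered_form i j).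
Proof.
rewrite /centered_form -scaleNr; apply: mhomogD.
  by move=> a /mhomogX ha l; rewrite ha tagnat.Rank1K.
exact/mhomogZ/mhomog_pivot.
Qed.

Lemma meval_pivot i : meval_coords x (pivot i) = 1.
Proof. by rewrite meval_var. Qed.

Lemma meval_centered_form i j : meval_coords x (@centered_form i j) = 0.
Proof.
rewrite /centered_form /meval_coords mevalB mevalZ.
by rewrite [X in X - _]meval_var [X in _ * X]meval_pivot mulr1 subrr.
Qed.

Lemma mhomog_pivot_pow d : is_mhomog d (pivot_pow d).
Proof.
move=> a /(mhomog_prod (fun i => mhomogXn (m := d i) (@mhomog_pivot i))) da l.
rewrite da (bigD1 l) //= eqxx mul1n big1 ?addn0 // => i /negPf->.
by rewrite mul0n.
Qed.

Lemma meval_pivot_pow d : meval_coords x (pivot_pow d) = 1.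
Proof.
rewrite /meval_coords rmorph_prod big1 // => i _.
by rewrite rmorphXn /= [X in X ^+ _]meval_pivot expr1n.
Qed.

Lemma pivot_powD d d' :
  pivot_pow (fun i => d i + d' i)%N = pivot_pow d * pivot_pow d'.
Proof. by rewrite -big_split; apply: eq_bigr => i _; apply: exprD. Qed.

Lemma pivot_pow1 i : pivot_pow (fun l => i == l) = pivot i.
Proof.
rewrite /pivot_pow [LHS](bigD1 i) //= eqxx expr1.
rewrite [X in _ * X]big1 ?mulr1 // => l.
by rewrite eq_sym => /negPf->.
Qed.

(** Homogenization, with the pivot variables as denominators: a one-sided
    inverse of [chart] up to a power of the pivots, see [rehom_chart]. *)
Definition rehom : A -> F :=
  mmap (@FracField.tofrac S \o @mpolyC _ K)
    (fun w => tofrac (local_param w) / tofrac (pivot (tagnat.sig1 w))).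
HB.instance Definition _ := GRing.RMorphism.on rehom.

Lemma pivot_neq0 i : tofrac (pivot i) != 0.
Proof.
rewrite tofrac_eq0; apply: contra_neq (oner_neq0 K) => p0.
by rewrite -(meval_pivot i) p0 /meval_coords meval0.
Qed.

Lemma rehom_chart_var (u : {i & 'I_(n i).+1}) :
  rehom (chart_var u) = tofrac 'X_(tagnat.rank u) / tofrac (pivot (tag u)).
Proof.
case: u => i j; rewrite /chart_var /= rmorphD /= [rehom _%:MP]mmapC /=.
case: unliftP => [j' eq_j|eq_j].
  rewrite [rehom _]mmapX mmap1U tagnat.Rank1K local_param_Rank -eq_j.
  rewrite /centered_form -mul_mpolyC tofracB tofracM mulrBl.
  rewrite mulfK ?pivot_neq0 //.
  by rewrite addrC subrK.
by rewrite rmorph0 addr0 eq_j xp tofrac1 divff ?pivot_neq0.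
Qed.

(** Both sides are multiplicative, and [rehom (chart 'X_v)] is ['X_v] divided by
    the pivot of its factor. A monomial of multidegree [d] collects exactly
    [d i] of these denominators from the factor [i]. *)
Lemma rehom_chart d f : is_mhomog d f ->
  rehom (chart f) * tofrac (pivot_pow d) = tofrac f.
Proof.
move=> df; rewrite {1}(mpolyE f) [in RHS](mpolyE f) (rmorph_sum chart) /=.
rewrite (rmorph_sum rehom) (rmorph_sum (@FracField.tofrac S)) mulr_suml.
apply: eq_big_seq => a a_f; rewrite chartZ -!mul_mpolyC /= tofracM.
rewrite (rmorphM rehom) /= [rehom _%:MP]mmapC /= -mulrA; congr (_ * _).
rewrite mpolyXE_id !rmorph_prod /=.
have ->: \prod_i tofrac (pivot i ^+ d i) =
         \prod_v tofrac (pivot (tagnat.sig1 v)) ^+ a v.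
  rewrite [RHS](partition_big (@tagnat.sig1 _ _) predT) //=.
  apply: eq_bigr => i _; rewrite -(df a a_f i) tofracXn -prodrXr.
  by apply: eq_bigr => v /eqP->.
rewrite -big_split; apply: eq_bigr => v _ /=; rewrite !tofracXn rmorphXn.
rewrite rmorphXn -exprMn; congr (_ ^+ _).
by rewrite /= chartX rehom_chart_var tagnat.sigK mulfVK // pivot_neq0.
Qed.

(** * Powers of the ideal of a point and order of vanishing *)

Context (P : mpoint K n) (xP : is_coords P x).
Local Notation I := (point_ideal P).

Lemma point_ideal_centered_form i j : I (@centered_form i j).
Proof.
apply: (mhomog_point_ideal xP (@mhomog_centered_form i j)).2.
exact: meval_centered_form.
Qed.

(** Clearing denominators one germ at a time avoids bounding the powers of the
    pivots: this relation is compatible with sums and products, so that it need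
    only be checked on [rehom 'X_w]. *)
Definition clears_into m (q : F) :=
  exists e f, ideal_exp I m f /\ tofrac (pivot_pow e) * q = tofrac f.

Lemma clears_into0 m : clears_into m 0.
Proof.
exists (fun=> 0%N), 0; rewrite mulr0 tofrac0; split=> //; exact: ideal_span0.
Qed.

Lemma clears_intoD m q r :
  clears_into m q -> clears_into m r -> clears_into m (q + r).
Proof.
move=> [e [f [If eq_f]]] [e' [f' [If' eq_f']]].
exists (fun i => e i + e' i)%N, (pivot_pow e' * f + pivot_pow e * f'); split.
  by apply: ideal_spanD; apply: ideal_spanM.
rewrite tofracD !tofracM -eq_f -eq_f' pivot_powD tofracM mulrDr.
by rewrite -!mulrA [in LHS]mulrCA.
Qed.

Lemma clears_intoM l m q r :
  clears_into l q -> clears_into m r -> clears_into (l + m) (q * r).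
Proof.
move=> [e [f [If eq_f]]] [e' [f' [If' eq_f']]].
exists (fun i => e i + e' i)%N, (f * f'); split; first exact: ideal_expM.
by rewrite tofracM -eq_f -eq_f' pivot_powD tofracM mulrACA.
Qed.

Lemma clears_into_leq l m q : (l <= m)%N -> clears_into m q -> clears_into l q.
Proof.
move=> le_lm [e [f [If ?]]]; exists e, f; split=> //.
exact: ideal_exp_leq If.
Qed.

Lemma clears_into_tofrac f : clears_into 0 (tofrac f).
Proof.
exists (fun=> 0%N), f; split; first exact: ideal_exp0.
by rewrite [pivot_pow _]big1 ?tofrac1 ?mul1r.
Qed.

Lemma clears_into_param w : clears_into 1 (rehom 'X_w).
Proof.
rewrite [rehom _]mmapX mmap1U; set i := tagnat.sig1 w.
exists (fun l => i == l), (local_param w); split.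
  exact/ideal_exp1/point_ideal_centered_form.
by rewrite pivot_pow1 mulrC divfK ?pivot_neq0.
Qed.

Lemma clears_into_monomial (a : 'X_{1..N}) :
  clears_into (mdeg a) (rehom 'X_[a]).
Proof.
rewrite mpolyXE_id (rmorph_prod rehom) mdegE.
elim/big_rec2: _ => [|w m q _ IH].
  by rewrite -tofrac1; apply: clears_into_tofrac.
apply: clears_intoM IH; elim: (a w) => [|b IHb].
  by rewrite expr0 rmorph1 -tofrac1; apply: clears_into_tofrac.
rewrite exprS rmorphM -add1n; apply: clears_intoM IHb.
exact: clears_into_param.
Qed.

Lemma clears_into_rehom m (h : A) :
  vanish_on (deg_lt m) h -> clears_into m (rehom h).
Proof.
move=> hm; rewrite (mpolyE h) (rmorph_sum rehom).
rewrite big_seq; elim/big_rec: _ => [|a q a_h]; first exact: clears_into0.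
apply: clears_intoD; apply: (@clears_into_leq _ (mdeg a)).
  by rewrite leqNgt; apply: contraL a_h => lt_a; rewrite -mcoeff_eq0 hm.
rewrite -mul_mpolyC (rmorphM rehom) /= [rehom _%:MP]mmapC -[mdeg a]add0n.
by apply: clears_intoM (clears_into_monomial a); apply: clears_into_tofrac.
Qed.

(** The pivot power is harmless for the stalk at the point, where it is
    invertible. *)
Lemma mhomog_ideal_exp m d f : is_mhomog d f ->
    vanish_on (deg_lt m) (chart f) ->
  exists e, ideal_exp I m (pivot_pow e * f).
Proof.
move=> df /clears_into_rehom[e [g [Ig eq_g]]]; exists e.
have <-: pivot_pow d * g = pivot_pow e * f; last exact: ideal_spanM.
apply/eqP; rewrite -tofrac_eq !tofracM -eq_g mulrCA; apply/eqP; congr (_ * _).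
by rewrite mulrC rehom_chart.
Qed.

(** An element of the ideal of the point expands without constant term, and
    orders of vanishing add up in products. *)
Lemma chart_ideal_exp m f :
  ideal_exp I m f -> vanish_on (deg_lt m) (chart f).
Proof.
move: f; apply: ideal_span_min => [|f g|c _ [g [Ig ->]]].
- by rewrite rmorph0 => a _; apply: mcoeff0.
- by rewrite rmorphD; apply: vanish_onD.
rewrite rmorphM rmorph_prod; apply/vanish_onM; first exact: lower_deg_lt.
elim: m g Ig => [|m IHm] g Ig; first by move=> a; rewrite inE.
rewrite big_ord_recl; apply: (@vanish_deg_ltM _ _ 1 m); last exact: IHm.
move=> a; rewrite inE ltnS leqn0 mdeg_eq0 => /eqP->.
by rewrite chart_const (point_ideal_meval xP).
Qed.

Lemma mhomog_notin_point_ideal d g : is_mhomog d g ->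
  ~ I g <-> meval_coords x g != 0.
Proof.
move=> dg; have [gI Ig] := mhomog_point_ideal xP dg.
by split=> [Ig'|/eqP gx /gI //]; apply/eqP => /Ig.
Qed.

(** * The length of the local ring modulo an order of vanishing *)

(** For [L] closed under divisors this is the ideal of the local ring given by
    the expansions that vanish on [L]. The condition bears on the numerator of
    one representative [f / g], which [germ_vanish_numerator] justifies. *)
Definition germ_vanish (L : {pred 'X_{1..N}}) (q : F) : Prop :=
  exists d f g, [/\ is_mhomog d f, is_mhomog d g, vanish_on L (chart f),
    meval_coords x g != 0 & q = tofrac f / tofrac g].

Lemma meval_tofrac_neq0 g : meval_coords x g != 0 -> tofrac g != 0.
Proof.
by rewrite tofrac_eq0; apply: contra_neq => ->; rewrite /meval_coords meval0.
Qed.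

(** From [f / g = f' / g'] one gets [chart f * chart g' = chart f' * chart g],
    and [chart g'] can be cancelled because its constant term is [g'(x)]. *)
Lemma germ_vanish_numerator L f g : lower_set L -> meval_coords x g != 0 ->
  germ_vanish L (tofrac f / tofrac g) -> vanish_on L (chart f).
Proof.
move=> lowL gx [d [f' [g' [_ _ Lf' gx' eq_q]]]].
have /eqP := eq_q; rewrite eqr_div ?meval_tofrac_neq0 // -!tofracM tofrac_eq.
move/eqP=> eqM; apply: (@vanish_on_cancel _ _ _ _ (chart g')) => //.
  by rewrite chart_const.
by rewrite -rmorphM mulrC eqM mulrC rmorphM; apply: vanish_onM.
Qed.

Lemma germ_vanish_sub (L L' : {pred 'X_{1..N}}) q :
  {subset L' <= L} -> germ_vanish L q -> germ_vanish L' q.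
Proof.
move=> sub [d [f [g [df dg Lf gx eq_q]]]]; exists d, f, g; split=> //.
by move=> a /sub/Lf.
Qed.

Lemma local_ringE q : local_ring P q <-> germ_vanish pred0 q.
Proof.
split=> -[d [f [g [df dg Lf gx ->]]]]; exists d, f, g; split=> //.
  exact/(mhomog_notin_point_ideal dg).
exact/(mhomog_notin_point_ideal dg).
Qed.

Lemma germ_vanish_submod L :
  lower_set L -> is_submod (local_ring P) (germ_vanish L).
Proof.
move=> lowL; split.
- exists (fun=> 0%N), 0, 1; split; rewrite ?tofrac0 ?mul0r ?rmorph0 //.
  + exact: mhomog0.
  + exact: (@mhomogC _ _ _ 1).
  + by move=> a _; apply: mcoeff0.
  + by rewrite /meval_coords meval1 oner_neq0.
- move=> _ _ [d [f [g [df dg Lf gx ->]]]] [d' [f' [g' [df' dg' Lf' gx' ->]]]].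
  exists (fun i => d i + d' i)%N, (f * g' + f' * g), (g * g'); split.
  + apply: mhomogD; first exact: mhomogM.
    by rewrite mulrC; apply: mhomogM.
  + exact: mhomogM.
  + rewrite rmorphD !rmorphM mulrC [X in _ + X]mulrC.
    by apply: vanish_onD; apply: vanish_onM.
  + by rewrite /meval_coords mevalM mulf_neq0.
  + by rewrite addf_div ?meval_tofrac_neq0 // tofracD !tofracM.
move=> a q /local_ringE[d [f [g [df dg _ gx ->]]]].
move=> [d' [f' [g' [df' dg' Lf' gx' ->]]]].
exists (fun i => d i + d' i)%N, (f * f'), (g * g').
split; try exact: mhomogM.
- by rewrite rmorphM; apply: vanish_onM.
- by rewrite /meval_coords mevalM mulf_neq0.
- by rewrite !tofracM mulf_div.
Qed.

Lemma local_ring_const c : local_ring P (tofrac (c%:MP : S)).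
Proof.
apply/local_ringE; exists (fun=> 0%N), c%:MP, 1; split=> //.
- exact: mhomogC.
- exact: (@mhomogC _ _ _ 1).
- by rewrite /meval_coords meval1 oner_neq0.
- by rewrite tofrac1 divr1.
Qed.

(** Linear combinations of germs with a common denominator reduce to linear
    combinations of their numerators, all of one multidegree. *)
Lemma common_denominator l (q : 'I_l -> F) : (forall t, local_ring P (q t)) ->
  exists d (f : 'I_l -> S) g, [/\ forall t, is_mhomog d (f t), is_mhomog d g,
    meval_coords x g != 0 & forall t, q t = tofrac (f t) / tofrac g].
Proof.
move=> Pq; have repr t : exists u : ('I_k -> nat) * S * S,
    [/\ is_mhomog u.1.1 u.1.2, is_mhomog u.1.1 u.2, meval_coords x u.2 != 0
      & q t = tofrac u.1.2 / tofrac u.2].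
  by have [d [f [g []]]] := (local_ringE _).1 (Pq t); exists (d, f, g).
have {repr Pq} [u /all_and4[df dg gx eq_q]] := fin_all_exists repr.
pose rest t := \prod_(t' | t' != t) (u t').2.
have eq_g t : \prod_t (u t).2 = (u t).2 * rest t by exact: bigD1.
exists (fun i => \sum_t (u t).1.1 i)%N, (fun t => (u t).1.2 * rest t).
exists (\prod_t (u t).2); split.
- move=> t a /(mhomogM (df t) (mhomog_prod dg)) da i.
  by rewrite da [RHS](bigD1 t).
- exact: mhomog_prod.
- by rewrite /meval_coords rmorph_prod; apply/prodf_neq0 => t _; apply: gx.
move=> t; have rest0 : tofrac (rest t) != 0.
  apply: meval_tofrac_neq0; rewrite /meval_coords rmorph_prod.
  by apply/prodf_neq0 => j _; apply: gx.
by rewrite (eq_g t) !tofracM -mulf_div divff // mulr1.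
Qed.

(** Pick in each step of the chain a germ outside of the smaller submodule. If
    there are more germs than monomials of degree less than [m], then some
    nontrivial combination of them expands to order [m], so lies in every
    submodule of the chain. The last germ with a nonzero coefficient is then a
    combination of this one and of earlier germs, so it lies in the submodule
    that it was chosen to avoid. *)
Lemma submod_chain_leq m l J :
  submod_chain (local_ring P) (local_ring P) (germ_vanish (deg_lt m)) l J ->
  (l <= #|{: 'X_{1..N < m}}|)%N.
Proof.
move=> cJ; have [subJ J0 Jl inc] := cJ; have monoJ := submod_chain_mono cJ.
have step (t : 'I_l) : exists q, J t.+1 q /\ ~ J t q by case: (inc t).
have {step} [q /all_and2[Jq Jq']] := fin_all_exists step.
have Pq t : local_ring P (q t).
  by apply/Jl/(monoJ t.+1)/Jq; rewrite ltn_ord leqnn.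
have [d [f [g [df dg gx eq_q]]]] := common_denominator Pq.
rewrite leqNgt; apply/negP => lt_card.
pose jet := \matrix_(t < l, a < #|{: 'X_{1..N < m}}|)
  (chart (f t))@_(enum_val a).
have : kermx jet != 0.
  rewrite -mxrank_eq0 mxrank_ker subn_eq0 -ltnNge.
  exact: leq_ltn_trans (rank_leq_col _) lt_card.
case/rowV0Pn=> c /sub_kermxP c_jet c0.
have /existsP[t1 ct1] : [exists t, c 0 t != 0].
  apply: contraNT c0; rewrite negb_exists => /forallP c0.
  by apply/eqP/rowP => t; rewrite mxE; apply/eqP; rewrite -[_ == _]negbK c0.
case: (@arg_maxnP _ t1 (fun t => c 0 t != 0) (@nat_of_ord l) ct1).
move=> t0 /= ct0 max_t0.
pose h := \sum_t c 0 t *: f t.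
have Jh : J t0 (tofrac h / tofrac g).
  apply: (monoJ 0%N); rewrite ?(ltnW (ltn_ord t0)) //.
  apply: J0; exists d, h, g; split=> //.
    by apply: mhomog_sum => t; apply: mhomogZ.
  move=> a lt_a; have /matrixP/(_ 0 (enum_rank (BMultinom lt_a))) := c_jet.
  rewrite !mxE => <-; rewrite (rmorph_sum chart) (raddf_sum (mcoeff a)) /=.
  by apply: eq_bigr => t _; rewrite chartZ mcoeffZ mxE enum_rankK.
have eq_h : tofrac h / tofrac g = \sum_t tofrac ((c 0 t)%:MP : S) * q t.
  rewrite (rmorph_sum (@FracField.tofrac S)) mulr_suml; apply: eq_bigr => t _.
  by rewrite eq_q /= -mul_mpolyC tofracM mulrA.
apply: (Jq' t0).
have [_ JD JM] := subJ t0 (ltnW (ltn_ord t0)).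
have -> : q t0 = tofrac (((c 0 t0)^-1)%:MP : S) *
    (tofrac h / tofrac g + \sum_(t | t != t0) tofrac ((- c 0 t)%:MP : S) * q t).
  rewrite eq_h (bigD1 t0) //= -addrA -big_split.
  rewrite [X in _ * (_ + X)]big1 /= => [|t _].
    by rewrite addr0 mulrA -tofracM -mpolyCM mulVf // mpolyC1 tofrac1 mul1r.
  by rewrite mpolyCN tofracN mulNr subrr.
apply: (JM _ _ (local_ring_const _)); apply: JD => //.
apply: is_submod_sum (subJ t0 (ltnW (ltn_ord t0))) _ => t neq_t.
(* A later germ has coefficient 0, by maximality of [t0]. *)
have [->|ct] := eqVneq (c 0 t) 0.
  by rewrite oppr0 mpolyC0 tofrac0 mul0r; case: (subJ t0 (ltnW (ltn_ord t0))).
apply: (JM _ _ (local_ring_const _)); apply: (monoJ t.+1) (Jq t).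
by rewrite (ltnW (ltn_ord t0)) andbT ltn_neqAle (max_t0 _ ct) neq_t.
Qed.

Lemma chart_monomial (a : 'X_{1..N}) :
  chart (\prod_w local_param w ^+ a w) = 'X_[a].
Proof.
rewrite mpolyXE_id (rmorph_prod chart); apply: eq_bigr => w _.
by rewrite rmorphXn /= chart_local_param.
Qed.

Lemma mhomog_monomial (a : 'X_{1..N}) :
  exists d, is_mhomog d (\prod_w local_param w ^+ a w).
Proof.
eexists; apply: mhomog_prod => w.
exact: (mhomogXn (@mhomog_centered_form _ _)).
Qed.

(** The submodule of index [t] asks for vanishing on all but the last [t]
    monomials of degree less than [m]. The step from [t] to [t.+1] frees one
    monomial, and the germ that expands to this monomial is new. *)
Lemma exists_submod_chain m : exists J,
  submod_chain (local_ring P) (local_ring P) (germ_vanish (deg_lt m))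
    #|{: 'X_{1..N < m}}| J.
Proof.
pose L t : {pred 'X_{1..N}} :=
  [pred a in take (#|{: 'X_{1..N < m}}| - t) (low_monomials N m)].
have lowL t : lower_set (L t) by exact: lower_take_low_monomials.
exists (fun t => germ_vanish (L t)); split.
- by move=> t _; apply: germ_vanish_submod.
- move=> q; apply: germ_vanish_sub => a; rewrite inE => /mem_take.
  by rewrite mem_low_monomials.
- by move=> q Lq; apply/local_ringE; apply: germ_vanish_sub Lq.
move=> t lt_t; set r := (#|{: 'X_{1..N < m}}| - t.+1)%N.
have def_r : (#|{: 'X_{1..N < m}}| - t = r.+1)%N by rewrite /r subnSK.
split.
  move=> q; apply: germ_vanish_sub => a; rewrite /L !inE def_r => a_r.
  by rewrite in_take ?(mem_take a_r) // ltnW // ltnS -in_take ?(mem_take a_r).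
have lt_r : (r < size (low_monomials N m))%N.
  by rewrite size_low_monomials -def_r leq_subr.
pose a := nth 0%MM (low_monomials N m) r.
have idx_a : index a (low_monomials N m) = r.
  by rewrite index_uniq // uniq_low_monomials.
have a_m : a \in low_monomials N m by rewrite mem_nth.
have [d da] := mhomog_monomial a.
(* Dividing by pivots gives multidegree 0 and does not change the expansion. *)
exists (tofrac (\prod_w local_param w ^+ a w) / tofrac (pivot_pow d)).
split.
  exists d, (\prod_w local_param w ^+ a w), (pivot_pow d).
  split=> //; rewrite ?meval_pivot_pow ?oner_neq0 //.
    exact: mhomog_pivot_pow.
  move=> b; rewrite inE => b_r; rewrite chart_monomial mcoeffX.
  case: eqP => // ab; move: b_r; rewrite -ab in_take //.
  by rewrite idx_a ltnn.
have px : meval_coords x (pivot_pow d) != 0.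
  by rewrite meval_pivot_pow oner_neq0.
move/(germ_vanish_numerator (lowL t) px)/(_ a).
rewrite chart_monomial mcoeffX eqxx !inE /L def_r in_take // idx_a ltnSn.
by move=> /(_ isT)/eqP; rewrite oner_eq0.
Qed.

Lemma length_germ_vanish m :
  is_length (local_ring P) (local_ring P) (germ_vanish (deg_lt m))
    #|{: 'X_{1..N < m}}|.
Proof. by split; [apply: exists_submod_chain | apply: submod_chain_leq]. Qed.

End AffineChart.

(** * Schemes of fat points *)

Section FatPoints.
Context (K : fieldType) (k : nat) (n : 'I_k -> nat).
Implicit Types (P Q : mpoint K n).

(** If all centered forms of [P] vanish at [Q], then the coordinates of [Q] are
    proportional to those of [P] in every factor. *)
Lemma separating_form P Q x : P != Q -> is_coords Q x ->
  exists d f, [/\ is_mhomog d f, point_ideal P f & meval_coords x f != 0].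
Proof.
move=> neq_PQ xQ; have [y [p [yP yp]]] := normalized_coords P.
have [/existsP[i /existsP[j nz]]|vanish] := boolP [exists i, exists j,
    meval_coords x (centered_form y p (i := i) j) != 0].
  exists (fun l => i == l : nat), (centered_form y p j); split=> //.
    exact: mhomog_centered_form.
  exact: (point_ideal_centered_form yp yP j).
case/eqP: neq_PQ; apply/ffunP => i; apply: val_inj; rewrite -yP -xQ.
have eq_x : x i = x i 0 (p i) *: y i.
  apply/rowP => j; rewrite mxE; apply/eqP; rewrite -subr_eq0.
  move: vanish; rewrite negb_exists => /forallP/(_ i).
  rewrite negb_exists => /forallP/(_ j); rewrite negbK.
  by rewrite /centered_form /meval_coords mevalB mevalZ [X in X - _]meval_var
    [X in _ * X]meval_var mulrC.
apply/esym/eqP; rewrite eqEdim -memvE {1}eq_x memvZ ?memv_line //.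
by rewrite yP xQ (eqP (valP (P i))) (eqP (valP (Q i))).
Qed.

Context (s : nat) (P : 'I_s -> mpoint K n) (m : 'I_s -> nat).

(** The product of the powers of separating forms for the points other than
    [Q], with the factor 1 for the occurrences of [Q]. *)
Lemma separating_form_exp Q x : is_coords Q x ->
  exists d f, [/\ is_mhomog d f, meval_coords x f != 0
    & forall i, P i != Q -> ideal_exp (point_ideal (P i)) (m i) f].
Proof.
move=> xQ; have sep i : exists u : ('I_k -> nat) * mring K n,
    [/\ is_mhomog u.1 u.2, meval_coords x u.2 != 0
      & P i != Q -> point_ideal (P i) u.2].
  have [|neq_PQ] := eqVneq (P i) Q.
    exists (fun=> 0%N, 1); split=> //; first exact: (@mhomogC _ _ _ 1).
    by rewrite /meval_coords meval1 oner_neq0.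
  by have [d [f []]] := separating_form neq_PQ xQ; exists (d, f).
have [u /all_and3[du ux uP]] := fin_all_exists sep.
exists (fun l => \sum_i (u i).1 l * m i)%N, (\prod_i (u i).2 ^+ m i); split.
- by apply: mhomog_prod => i; apply: mhomogXn.
- rewrite /meval_coords rmorph_prod; apply/prodf_neq0 => i _.
  by rewrite rmorphXn expf_neq0 // ux.
move=> i neq_PQ; rewrite (bigD1 i) //= mulrC; apply/ideal_spanM/ideal_expX.
exact: uP.
Qed.

(** The maximum of an empty family is 0, the multiplicity outside of the
    support. If [Q] occurs several times, the largest exponent gives the
    intersection of the powers of its ideal. *)
Definition multiplicity Q := (\max_(i | P i == Q) m i)%N.

(** For the inclusion from right to left, [f / g] is rewritten as
    [t * f / (t * g)] with [t] nonzero at [Q]: its first factor brings [f] into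
    the power of the ideal of [Q], its second one into those of the other
    points. *)
Lemma stalk_fat_points Q x p : is_coords Q x -> (forall i, x i 0 (p i) = 1) ->
  forall q, stalk (fat_points_ideal P m) Q q <->
            germ_vanish x p (deg_lt (multiplicity Q)) q.
Proof.
move=> xQ xp q; split=> -[d [f [g [df dg If gx ->]]]].
  exists d, f, g; split=> //; last exact/(mhomog_notin_point_ideal xQ dg).
  move=> a; rewrite inE ltnNge => /bigmax_leqP lt_a.
  have [i /andP[/eqP PiQ lt_i]|no] :=
    pickP (fun i => (P i == Q) && (mdeg a < m i)%N).
    have := If i; rewrite PiQ => /(chart_ideal_exp p xQ); apply.
    by rewrite inE.
  case: lt_a => i PiQ; have := no i; rewrite PiQ /= => /negbT.
  by rewrite -leqNgt.
have [e Ie] := mhomog_ideal_exp xp xQ df If.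
have [d' [h [dh hx Ih]]] := separating_form_exp xQ.
pose t := pivot_pow K p e * h.
have tx : meval_coords x t != 0.
  rewrite /meval_coords mevalM mulf_neq0 //.
  by rewrite [X in X != _](meval_pivot_pow xp) oner_neq0.
have dt := mhomogM (mhomog_pivot_pow (p := p) (d := e)) dh.
exists (fun i => (e i + d' i) + d i)%N, (t * f), (t * g); split.
- exact: mhomogM.
- exact: mhomogM.
- move=> i; have [PiQ|neq_PQ] := eqVneq (P i) Q; last first.
    by rewrite /t mulrAC; apply/ideal_spanM/Ih.
  rewrite /t mulrAC mulrC PiQ; apply/ideal_spanM; apply: ideal_exp_leq Ie.
  by apply: leq_bigmax_cond; apply/eqP.
- apply: (mhomog_notin_point_ideal xQ (mhomogM dt dg)).2.
  by rewrite /meval_coords mevalM mulf_neq0.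
by rewrite !(tofracM t) -mulf_div (divff (meval_tofrac_neq0 tx)) mul1r.
Qed.

(** At a point outside of the support no monomial has degree less than 0, and
    the length is 0. *)
Lemma local_length_fat_points Q :
  local_length (fat_points_ideal P m) Q
    #|{: bmultinom (\sum_(i < k) n i) (multiplicity Q)}|.
Proof.
have [x [p [xQ xp]]] := normalized_coords Q.
have stalkE := stalk_fat_points xQ xp.
have [[J cJ] max] := length_germ_vanish xp xQ (multiplicity Q).
split.
  case: cJ => sub J0 Jl inc; exists J; split=> // q /stalkE; exact: J0.
move=> l J' [sub J0 Jl inc]; apply: (max l J'); split=> // q /stalkE; exact: J0.
Qed.

Lemma degree_fat_points : injective P -> (forall i, 0 < m i)%N ->
  is_degree (fat_points_ideal P m)
    (\sum_(i < s) 'C((\sum_(j < k) n j) + m i - 1, m i - 1))%N.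
Proof.
move=> P_inj m_gt0; set N := (\sum_(j < k) n j)%N.
exists (fun Q => #|{: 'X_{1..N < multiplicity Q}}|); split.
  exact: local_length_fat_points.
exists (codom P); split.
- by rewrite map_inj_uniq ?enum_uniq.
- move=> Q; apply: contraR => PQ; rewrite /multiplicity big_pred0 => [|i].
    by apply/eqP/eq_card0 => -[].
  by apply: contraNF PQ => /eqP<-; apply: codom_f.
rewrite big_map big_enum; apply: eq_bigr => i _.
have -> : multiplicity (P i) = m i.
  by rewrite /multiplicity (big_pred1 i) // => j; rewrite (inj_eq P_inj).
case: (m i) (m_gt0 i) => // b _.
by rewrite card_bmultinom addnS !subn1.
Qed.

End FatPoints.

Theorem proposition1p7 (K : closedFieldType) (charK : [pchar K] =i pred0)
    (k : nat) (k_gt0 : (0 < k)%N)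
    (n : 'I_k -> nat) (n_gt0 : forall i, (0 < n i)%N)
    (s : nat) (s_gt0 : (0 < s)%N)
    (P : 'I_s -> mpoint K n) (P_inj : injective P)
    (m : 'I_s -> nat) (m_gt0 : forall i, (0 < m i)%N) :
  let N := (\sum_(i < k) n i)%N in
  is_degree (fat_points_ideal P m)
    (\sum_(i < s) 'C(N + m i - 1, m i - 1))%N.
Proof. exact: degree_fat_points. Qed.
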